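(* Let $n$ and $l$ be positive integers, let $C>0$ be a fixed constant, let $(x_1,y_1),\ldots,(x_l,y_l)$ be a sample with $x_i\in\mathbb{R}^n$ and $y_i\in\{-1,1\}$, and let $x_{l+1}\in\mathbb{R}^n$ be one further (unclassified) example. If the sample $(x_1,y_1),\ldots,(x_l,y_l)$ contains both positive examples (some $y_i=1$) and negative examples (some $y_i=-1$), then $z_{l+1}=(x_{l+1},y_{l+1})$ is a support vector in at least one of the two pictures, the $1$-picture and the $-1$-picture.
   Context: For $y\in\{-1,1\}$, the $y$-picture is the set of $l+1$ classified examples $(x_1,y_1),\ldots,(x_l,y_l),(x_{l+1},y_{l+1})$ with $y_{l+1}=y$. Support vectors: given classified examples $(x_1,y_1),\ldots,(x_{l+1},y_{l+1})$ with $x_i\in\mathbb{R}^n$, $y_i\in\{-1,1\}$, consider the problem of minimizing $$\Phi(w,\xi)=\frac12 (w\cdot w)+C\sum_{i=1}^{l+1}\xi_i^2$$ over $w\in\mathbb{R}^n$, $b\in\mathbb{R}$, $\xi=(\xi_1,\ldots,\xi_{l+1})\in\mathbb{R}^{l+1}$, subject to $$y_i((w\cdot x_i)+b)\ge 1-\xi_i,\qquad \xi_i\ge 0,\qquad i=1,\ldots,l+1,$$ where $(u\cdot v)$ is the standard inner product. When both positive and negative examples are present this problem has a unique solution $(w,b,\xi)$. The example $(x_i,y_i)$ is called a support vector if at this solution the corresponding constraint holds as an equality: $y_i((w\cdot x_i)+b)=1-\xi_i$. *)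

(* Defs.v *)
From mathcomp Require Import all_boot all_order all_algebra.
From mathcomp Require Import reals.

Set Implicit Arguments.
Unset Strict Implicit.
Unset Printing Implicit Defensive.

Import Order.TTheory GRing.Theory Num.Theory.
Local Open Scope ring_scope.

Definition dot (R : realType) (n : nat) (u v : 'rV[R]_n) : R :=
  \sum_(j < n) u 0 j * v 0 j.

(* A classified example (x, y); that y is -1 or 1 is a separate hypothesis. *)
Definition example (R : realType) (n : nat) : Type := ('rV[R]_n * R)%type.

Section SVM.
Variables (R : realType) (n N : nat) (C : R) (z : 'I_N -> example R n).

Definition objective (w : 'rV[R]_n) (xi : 'rV[R]_N) : R :=
  2^-1 * dot w w + C * \sum_(i < N) xi 0 i ^+ 2.

Definition feasible (w : 'rV[R]_n) (b : R) (xi : 'rV[R]_N) : Prop :=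
  forall i : 'I_N,
    (z i).2 * (dot w (z i).1 + b) >= 1 - xi 0 i /\ xi 0 i >= 0.

Definition is_solution (w : 'rV[R]_n) (b : R) (xi : 'rV[R]_N) : Prop :=
  feasible w b xi /\
  forall (w' : 'rV[R]_n) (b' : R) (xi' : 'rV[R]_N),
    feasible w' b' xi' -> objective w xi <= objective w' xi'.

Definition is_unique_solution (w : 'rV[R]_n) (b : R) (xi : 'rV[R]_N) : Prop :=
  is_solution w b xi /\
  forall (w' : 'rV[R]_n) (b' : R) (xi' : 'rV[R]_N),
    is_solution w' b' xi' -> [/\ w' = w, b' = b & xi' = xi].

(* "The constraint of example i is an equality at the solution": the definite
   description is read as existence and uniqueness of the solution. *)
Definition support_vector (i : 'I_N) : Prop :=
  exists (w : 'rV[R]_n) (b : R) (xi : 'rV[R]_N),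
    is_unique_solution w b xi /\
    (z i).2 * (dot w (z i).1 + b) = 1 - xi 0 i.
End SVM.

(* The new example (xnew, y) has index [ord_max], after the l given ones. *)
Definition picture (R : realType) (n l : nat) (z : 'I_l -> example R n)
    (xnew : 'rV[R]_n) (y : R) : 'I_l.+1 -> example R n :=
  fun i => if unlift ord_max i is Some j then z j else (xnew, y).

(* Main.v *)
Require Import Defs.
From mathcomp Require Import all_boot all_order all_algebra.
From mathcomp Require Import ring lra.
From mathcomp Require Import boolp classical_sets reals topology normedtype derive.
Import Order.TTheory GRing.Theory Num.Theory.
Import numFieldNormedType.Exports.
Local Open Scope ring_scope.

(** Each picture has a unique solution: a minimum exists by compactness, and the
objective is strictly convex in [(w, xi)]. If the new example were not a support
vector in either picture, both solutions would classify it correctly with margin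
greater than 1 and with slack 0. Take the picture whose solution has the larger
objective, and move slightly from it towards the other solution: the new
constraint stays satisfied, all others are satisfied by convexity, and the
objective does not increase. By uniqueness the two solutions coincide, but they
classify the new example differently. *)

Section Solutions.
Set Implicit Arguments.
Unset Strict Implicit.
Context {R : realType} {n N : nat}.
Implicit Types (w : 'rV[R]_n) (b t : R) (xi : 'rV[R]_N).

(** * Convexity of the objective and of the constraints *)

Lemma dotDZl (s t : R) (u v x : 'rV[R]_n) :
  dot (s *: u + t *: v) x = s * dot u x + t * dot v x.
Proof.
rewrite /dot !mulr_sumr -big_split; apply: eq_bigr => j _.
by rewrite !mxE /=; ring.
Qed.

Lemma dotZl (t : R) (u x : 'rV[R]_n) : dot (t *: u) x = t * dot u x.
Proof. by rewrite /dot mulr_sumr; apply: eq_bigr => j _; rewrite mxE mulrA. Qed.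

Lemma dot_ge0 m (u : 'rV[R]_m) : 0 <= dot u u.
Proof. by apply: sumr_ge0 => j _; rewrite -expr2 sqr_ge0. Qed.

Context {C : R} (z : 'I_N -> example R n).

Lemma objectiveE w xi :
  objective C w xi = 2^-1 * dot w w + C * dot xi xi.
Proof. by rewrite /objective; congr (_ + _ * _); apply: eq_bigr => i _; rewrite expr2. Qed.

(** The defect of convexity is kept exactly, because the uniqueness of [w] and [xi] is read off from
    it. *)
Lemma sqr_dot_convex m (t : R) (u v : 'rV[R]_m) :
  dot ((1 - t) *: u + t *: v) ((1 - t) *: u + t *: v) =
  (1 - t) * dot u u + t * dot v v - t * (1 - t) * dot (u - v) (u - v).
Proof.
rewrite /dot !mulr_sumr -sumrN -!big_split; apply: eq_bigr => j _.
by rewrite !mxE /=; ring.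
Qed.

Lemma objective_convex t w w' xi xi' :
  objective C ((1 - t) *: w + t *: w') ((1 - t) *: xi + t *: xi') =
  (1 - t) * objective C w xi + t * objective C w' xi'
    - t * (1 - t) * objective C (w - w') (xi - xi').
Proof. by rewrite !objectiveE !sqr_dot_convex; ring. Qed.

Lemma objectiveZ t w xi :
  objective C (t *: w) (t *: xi) = t ^+ 2 * objective C w xi.
Proof.
have sqZ m (u : 'rV[R]_m) : dot (t *: u) (t *: u) = t ^+ 2 * dot u u.
  by rewrite /dot mulr_sumr; apply: eq_bigr => j _; rewrite !mxE; ring.
by rewrite !objectiveE !sqZ; ring.
Qed.

(** This concerns a single example because the two pictures differ in their last one: their
    solutions are mixed constraint by constraint. *)
Lemma constraint_convex (e : example R n) t w w' b b' (s s' : R) : 0 <= t <= 1 ->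
  1 - s <= e.2 * (dot w e.1 + b) -> 1 - s' <= e.2 * (dot w' e.1 + b') ->
  1 - ((1 - t) * s + t * s') <=
    e.2 * (dot ((1 - t) *: w + t *: w') e.1 + ((1 - t) * b + t * b')).
Proof.
move=> /andP[t0 t1]; rewrite dotDZl -subr_ge0 => m; rewrite -subr_ge0 => m'.
have : 0 <= (1 - t) * (e.2 * (dot w e.1 + b) - (1 - s)).
  by rewrite mulr_ge0// subr_ge0.
have := mulr_ge0 t0 m'.
move: (dot w _) (dot w' _) => d d'; lra.
Qed.

Lemma feasible_convex t w w' b b' xi xi' : 0 <= t <= 1 ->
  feasible z w b xi -> feasible z w' b' xi' ->
  feasible z ((1 - t) *: w + t *: w') ((1 - t) * b + t * b')
    ((1 - t) *: xi + t *: xi').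
Proof.
move=> t01 f f' i; have [m p] := f i; have [m' p'] := f' i.
rewrite !mxE; split; first exact: constraint_convex.
by case/andP: t01 => t0 t1; rewrite addr_ge0// mulr_ge0// subr_ge0.
Qed.

(** * Uniqueness of the solution *)

Hypothesis C_gt0 : 0 < C.

Lemma objective_ge0 w xi : 0 <= objective C w xi.
Proof.
by rewrite objectiveE addr_ge0// mulr_ge0 ?dot_ge0 ?invr_ge0 ?(ltW C_gt0).
Qed.

Lemma dot_eq0 m (u : 'rV[R]_m) : dot u u = 0 -> u = 0.
Proof.
move=> /eqP; rewrite psumr_eq0 => [/allP u0|j _]; last by rewrite -expr2 sqr_ge0.
apply/rowP => j; rewrite mxE; apply/eqP.
by have := u0 j (mem_index_enum j); rewrite mulf_eq0 orbb.
Qed.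

Lemma objective_le0 w xi : objective C w xi <= 0 -> w = 0 /\ xi = 0.
Proof.
rewrite objectiveE => o0.
have w0 := dot_ge0 w; have Cx : 0 <= C * dot xi xi by rewrite mulr_ge0 ?dot_ge0// ltW.
split; apply: dot_eq0; first by lra.
by have /eqP : C * dot xi xi = 0 by [lra]; rewrite mulf_eq0 gt_eqF// => /eqP.
Qed.

(** At the midpoint of two solutions the objective drops by a quarter of the objective of their
    difference, which must therefore vanish. The threshold does not enter the objective and needs a
    separate argument. *)
Lemma solution_eq w b xi w' b' xi' :
  is_solution C z w b xi -> is_solution C z w' b' xi' -> w' = w /\ xi' = xi.
Proof.
move=> [f o] [f' o'].
have h : 0 <= (2^-1 : R) <= 1 by lra.
have := o _ _ _ (feasible_convex h f f').
rewrite objective_convex => q; have oo' := o' _ _ _ f.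
have [|w0 xi0] := @objective_le0 (w - w') (xi - xi'); first by lra.
by split; apply/esym/eqP; rewrite -subr_eq0; apply/eqP.
Qed.

Lemma solution_slack0 w b xi i :
  is_solution C z w b xi -> 1 - xi 0 i < (z i).2 * (dot w (z i).1 + b) ->
  xi 0 i = 0.
Proof.
move=> [f o] slack; have [_ xi_ge0] := f i.
apply/eqP; rewrite eq_le xi_ge0 andbT leNgt; apply/negP => xi_gt0.
(* The least slack that example [i] admits at [(w, b)]; lowering [xi 0 i] to it would strictly
   decrease the objective. *)
pose m := Num.max 0 (1 - (z i).2 * (dot w (z i).1 + b)).
have m_ge0 : 0 <= m by rewrite le_max lexx.
have m_lt : m < xi 0 i by rewrite gt_max xi_gt0; lra.
pose xi' : 'rV[R]_N := \row_j if j == i then m else xi 0 j.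
have /o : feasible z w b xi'.
  move=> j; rewrite mxE; case: eqP => [->|_]; last exact: f.
  split=> //; have : 1 - (z i).2 * (dot w (z i).1 + b) <= m.
    by rewrite le_max lexx orbT.
  lra.
rewrite /objective lerD2l ler_pM2l// (bigD1 i)//= [leRHS](bigD1 i)//=.
have -> : \sum_(j | j != i) xi' 0 j ^+ 2 = \sum_(j | j != i) xi 0 j ^+ 2.
  by apply: eq_bigr => j /negPf ji; rewrite mxE ji.
by rewrite lerD2r mxE eqxx leNgt ltr_pXn2r ?nnegrE ?m_lt.
Qed.

Hypothesis z_label : forall i, (z i).2 = -1 \/ (z i).2 = 1.
Hypothesis z_pos : exists i, (z i).2 = 1.
Hypothesis z_neg : exists i, (z i).2 = -1.

(* If the solution admitted two thresholds, all constraints would be slack by a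
uniform amount at their mean, so everything could be scaled down. *)
Lemma solution_threshold_le w b b' xi :
  is_solution C z w b xi -> is_solution C z w b' xi -> b' <= b.
Proof.
move=> [f o] [f' _]; rewrite leNgt; apply/negP => bb'.
(* The mean threshold is [b + d] and also [b' - d], so label 1 gains [d] over [b] and label -1 gains
   [d] over [b']. Each right side becomes [1 + d - xi 0 i], and the factor [t] brings [1 + d] back
   to 1. *)
pose d := (b' - b) / 2; have d_gt0 : 0 < d by rewrite /d; lra.
pose t := (1 + d)^-1.
have t_gt0 : 0 < t by rewrite invr_gt0; lra.
have td : t * (1 + d) = 1 by rewrite mulVf// gt_eqF//; lra.
have ft : feasible z (t *: w) (t * ((b + b') / 2)) (t *: xi).
  move=> i; have [m p] := f i; have [m' _] := f' i.
  rewrite !mxE dotZl; split; last by rewrite mulr_ge0// ltW.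
  have : 0 <= t * ((z i).2 * (dot w (z i).1 + (b + b') / 2) + xi 0 i - (1 + d)).
    rewrite mulr_ge0 ?(ltW t_gt0)// subr_ge0 /d.
    by case: (z_label i) m m' => ->; lra.
  move: (dot w _) => e; rewrite mulrBr td; nra.
have t_lt1 : t < 1 by nra.
have := o _ _ _ ft; rewrite objectiveZ => le_ot.
have t2 : t ^+ 2 < 1 by rewrite expr2; nra.
(* Optimality against the factor [t ^+ 2 < 1] leaves only objective 0. With [w] and [xi] zero, the
   two classes demand [b >= 1] and [b <= -1]. *)
have [|w0 xi0] := @objective_le0 w xi; first by nra.
have [i ip] := z_pos; have [j jn] := z_neg.
have [+ _] := f i; have [+ _] := f j.
rewrite ip jn w0 xi0 !mxE.
have dot0 x : dot (0 : 'rV[R]_n) x = 0.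
  by rewrite /dot big1// => k _; rewrite mxE mul0r.
by rewrite !dot0; lra.
Qed.

Lemma solution_unique w b xi :
  is_solution C z w b xi -> is_unique_solution C z w b xi.
Proof.
move=> s; split=> // w' b' xi' s'.
have [ww xx] := solution_eq s s'; rewrite {}ww {}xx in s' *.
split=> //; apply/eqP; rewrite eq_le.
by rewrite (solution_threshold_le s s') (solution_threshold_le s' s).
Qed.

(** * Existence of the solution *)

Let hinge (p : 'rV[R]_n * R) : 'rV[R]_N :=
  \row_i Num.max 0 (1 - (z i).2 * (dot p.1 (z i).1 + p.2)).

Let loss (p : 'rV[R]_n * R) : R := objective C p.1 (hinge p).

Lemma hinge_feasible p : feasible z p.1 p.2 (hinge p).
Proof.
move=> i; rewrite mxE; split; last by rewrite le_max lexx.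
have : 1 - (z i).2 * (dot p.1 (z i).1 + p.2) <=
  Num.max 0 (1 - (z i).2 * (dot p.1 (z i).1 + p.2)) by rewrite le_max lexx orbT.
lra.
Qed.

(** For fixed [(w, b)] the hinge slacks are the least feasible ones, so the problem reduces to
    minimizing [loss] without constraints. *)
Lemma hinge_loss_le w b xi : feasible z w b xi -> loss (w, b) <= objective C w xi.
Proof.
move=> f; rewrite /loss /objective lerD2l ler_pM2l//; apply: ler_sum => i _.
have [m p] := f i.
rewrite mxE ler_pXn2r ?nnegrE ?le_max ?lexx//= ge_max p /=; lra.
Qed.

Lemma continuous_fst_coord j : continuous (fun p : 'rV[R]_n * R => p.1 0 j).
Proof.
move=> p; apply: (@continuous_comp _ _ _ fst (fun v : 'rV[R]_n => v 0 j)).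
  exact: cvg_fst.
exact: coord_continuous.
Qed.

Lemma continuous_dot (x : 'rV[R]_n) : continuous (fun p : 'rV[R]_n * R => dot p.1 x).
Proof.
move=> p; rewrite /dot; apply: cvg_big => [|j _]; first exact: add_continuous.
by apply: cvgM; [exact: continuous_fst_coord|exact: cvg_cst].
Qed.

Lemma continuous_hinge i : continuous (fun p => hinge p 0 i).
Proof.
pose margin (p : 'rV[R]_n * R) := (z i).2 * (dot p.1 (z i).1 + p.2).
have -> : (fun p => hinge p 0 i) = (fun p => Num.max 0 (1 - margin p)).
  by apply/funext => p; rewrite mxE.
move=> p; apply: (@continuous_max R _ (fun=> 0) (fun q => 1 - margin q) p).
  exact: cvg_cst.
apply: cvgB; first exact: cvg_cst.
apply: cvgM; first exact: cvg_cst.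
apply: cvgD; last exact: cvg_snd.
exact: continuous_dot.
Qed.

Lemma continuous_loss : continuous loss.
Proof.
move=> p; rewrite /loss /objective.
apply: cvgD; apply: cvgM; try exact: cvg_cst.
  rewrite /dot; apply: cvg_big => [|j _]; first exact: add_continuous.
  by apply: cvgM; exact: continuous_fst_coord.
apply: cvg_big => [|i _]; first exact: add_continuous.
rewrite [X in (_ --> X)%classic]expr2; under eq_fun do rewrite expr2.
by apply: cvgM; exact: continuous_hinge.
Qed.

Lemma normr_dot_le (W : R) w (x : 'rV[R]_n) :
  (forall j, `|w 0 j| <= W) -> `|dot w x| <= W * \sum_j `|x 0 j|.
Proof.
move=> wW; rewrite mulr_sumr; apply: (le_trans (ler_norm_sum _ _ _)).
by apply: ler_sum => j _; rewrite normrM ler_wpM2r.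
Qed.

(* A bounded loss bounds [w] directly, and bounds [b] on each side through the
hinge term of an example of the corresponding class. *)
Lemma loss_coercive (F : R) : exists W B : R, forall p, loss p <= F ->
  (forall j, `|p.1 0 j| <= W) /\ `|p.2| <= B.
Proof.
have [i ip] := z_pos; have [k kn] := z_neg.
(* Both constants come from [a <= 1 + a ^+ 2], as the squared coordinates of [w] are at most [2 * F]
   and the squared hinge slacks at most [F / C]. *)
pose W := 1 + 2 * F; pose H := 1 + F / C.
pose B := H + W * \sum_j `|(z i).1 0 j| + W * \sum_j `|(z k).1 0 j|.
exists W, B => p lF.
have sq_ge0 m (u : 'rV[R]_m) j : u 0 j ^+ 2 <= dot u u.
  rewrite /dot (bigD1 j)//= -expr2 lerDl.
  by apply: sumr_ge0 => ? _; rewrite -expr2 sqr_ge0.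
have le_of_sq (a c : R) : a ^+ 2 <= c -> a <= 1 + c by move=> ?; nra.
move: lF; rewrite /loss objectiveE => lF.
have Ch : 0 <= C * dot (hinge p) (hinge p) by rewrite mulr_ge0 ?dot_ge0// ltW.
have wW j : `|p.1 0 j| <= W.
  rewrite le_of_sq// real_normK ?num_real//; have := sq_ge0 _ p.1 j; lra.
have hH j : hinge p 0 j <= H.
  rewrite le_of_sq// ler_pdivlMr// mulrC (le_trans (ler_wpM2l (ltW C_gt0) (sq_ge0 _ _ j)))//.
  by have := dot_ge0 p.1; lra.
split=> //.
have Wx q := @normr_dot_le W p.1 q wW.
have H_ge0 : 0 <= H.
  rewrite addr_ge0// divr_ge0 ?(ltW C_gt0)//; have := dot_ge0 p.1; lra.
have [+ _] := hinge_feasible p i; have [+ _] := hinge_feasible p k.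
rewrite ip kn ler_norml /B.
have := Wx (z i).1; have := Wx (z k).1; have := hH i; have := hH k.
rewrite !ler_norml => ? ? /andP[? ?] /andP[? ?] ? ?.
have Wx_ge0 (q : 'rV[R]_n) : 0 <= W * \sum_j `|q 0 j| := le_trans (normr_ge0 _) (Wx q).
have := Wx_ge0 (z i).1; have := Wx_ge0 (z k).1 => ? ?.
by apply/andP; split; lra.
Qed.

Lemma exists_unique_solution : exists w b xi, is_unique_solution C z w b xi.
Proof.
(* Outside the box [K] the loss exceeds its value at the origin, which lies in [K]; a minimum over
   [K] is thus global. *)
have [W [B WB]] := loss_coercive (loss (0, 0)).
pose K : set ('rV[R]_n * R) :=
  ([set w : 'rV[R]_n | forall j, `[- W, W]%classic (w 0 j)] `*` `[- B, B])%classic.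
have inK p : loss p <= loss (0, 0) -> K p.
  move=> /WB[wW bB]; split=> /= [j|]; first by rewrite in_itv/= -ler_norml.
  by rewrite in_itv/= -ler_norml.
have K0 : K (0, 0) by apply: inK.
have cK : compact K.
  apply: compact_setX; last exact: segment_compact.
  by apply: (@rV_compact _ n (fun=> `[- W, W]%classic)) => _; exact: segment_compact.
have [||p _ pmin] := @compact_EVT_min _ R loss K _ cK.
- by exists (0, 0).
- by apply: continuous_subspaceT; exact: continuous_loss.
have lp q : loss p <= loss q.
  have [/inK Kq|/ltW q0] := leP (loss q) (loss (0, 0)).
    by apply: pmin; rewrite inE.
  by apply: le_trans q0; apply: pmin; rewrite inE.
exists p.1, p.2, (hinge p); apply: solution_unique; split=> [|w b xi f].
  exact: hinge_feasible.
exact: le_trans (lp (w, b)) (hinge_loss_le f).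
Qed.

End Solutions.

(** * Comparison of the two pictures *)

Section Pictures.
Set Implicit Arguments.
Unset Strict Implicit.
Context {R : realType} {n l : nat} {C : R}.
Variables (z : 'I_l -> example R n) (xnew : 'rV[R]_n).

Lemma picture_max (y : R) : picture z xnew y ord_max = (xnew, y).
Proof. by rewrite /picture unlift_none. Qed.

Lemma picture_lift (y : R) i : picture z xnew y (lift ord_max i) = z i.
Proof. by rewrite /picture liftK. Qed.

Lemma nonsupport_slack0 (y : R) w b xi (C_gt0 : 0 < C) :
  ~ support_vector C (picture z xnew y) ord_max ->
  is_unique_solution C (picture z xnew y) w b xi ->
  xi 0 ord_max = 0 /\ 1 < y * (dot w xnew + b).
Proof.
move=> nsv u; have [s _] := u; have [f _] := s; have [m _] := f ord_max.
have slack : 1 - xi 0 ord_max < y * (dot w xnew + b).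
  move: m; rewrite picture_max le_eqVlt => /orP[/eqP e|//]; exfalso; apply: nsv.
  by exists w, b, xi; split=> //; rewrite picture_max.
have xi0 : xi 0 ord_max = 0.
  by apply: (solution_slack0 C_gt0 s); rewrite picture_max.
by split=> //; rewrite xi0 subr0 in slack.
Qed.

(** The labels are left arbitrary because either picture may have the larger objective, and the move
    starts from that one. *)
Lemma nonsupport_solution_eq (y y' : R) w b xi w' b' xi' (C_gt0 : 0 < C) :
  is_unique_solution C (picture z xnew y) w b xi ->
  xi 0 ord_max = 0 -> 1 < y * (dot w xnew + b) ->
  feasible (picture z xnew y') w' b' xi' -> xi' 0 ord_max = 0 ->
  objective C w' xi' <= objective C w xi ->
  w' = w /\ b' = b.
Proof.
move=> [[f o] uniq] xi0 m f' xi'0 le_o.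
(* Since both slacks of the new example are 0, its excess margin after a move by [t] is at least
   [(1 - t) * s - t * a]; the chosen [t] makes this bound 0. *)
pose s := y * (dot w xnew + b) - 1; pose a := `|y * (dot w' xnew + b') - 1|.
have s_gt0 : 0 < s by rewrite subr_gt0.
have a_ge0 : 0 <= a by exact: normr_ge0.
have sa_gt0 : 0 < s + a by lra.
pose t := s / (s + a).
have t_gt0 : 0 < t by rewrite divr_gt0.
have t_le1 : t <= 1 by rewrite ler_pdivrMr// mul1r lerDl.
have t01 : 0 <= t <= 1 by rewrite ltW.
have tsa : t * (s + a) = s by rewrite divfK// gt_eqF.
pose wt := (1 - t) *: w + t *: w'; pose bt := (1 - t) * b + t * b'.
pose xit := (1 - t) *: xi + t *: xi'.
have ft : feasible (picture z xnew y) wt bt xit.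
  move=> i; have [mi p] := f i; have [mi' p'] := f' i; split; last first.
    by rewrite !mxE addr_ge0// mulr_ge0 ?(ltW t_gt0)// subr_ge0.
  move: mi mi'; rewrite /wt /bt !mxE; case: (unliftP ord_max i) => [j|] ->.
    by rewrite !picture_lift; exact: constraint_convex.
  move=> _ _; rewrite !picture_max/= dotDZl xi0 xi'0.
  have : - a <= y * (dot w' xnew + b') - 1 by rewrite lerNnormlW.
  rewrite -(ler_pM2l t_gt0) mulrN; move: tsa; rewrite /s.
  move: (dot w _) (dot w' _) => d d'; lra.
have le_ot : objective C wt xit <= objective C w xi.
  rewrite objective_convex.
  have : 0 <= t * (1 - t) * objective C (w - w') (xi - xi').
    by rewrite mulr_ge0 ?objective_ge0// mulr_ge0 ?(ltW t_gt0)// subr_ge0.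
  have : 0 <= t * (objective C w xi - objective C w' xi').
    by rewrite mulr_ge0 ?(ltW t_gt0)// subr_ge0.
  lra.
(* The moved point is feasible and no worse, hence a solution, hence the starting point; [t] being
   nonzero, the two ends of the move agree. *)
have [|wtw btb _] := uniq wt bt xit.
  by split=> // w2 b2 xi2 /o; exact: le_trans.
have t_neq0 : t != 0 by rewrite gt_eqF.
split.
  apply: (scalerI t_neq0); apply: (addrI ((1 - t) *: w)).
  by rewrite -/wt wtw -scalerDl subrK scale1r.
apply: (mulfI t_neq0); apply: (addrI ((1 - t) * b)).
by rewrite -/bt btb -mulrDl subrK mul1r.
Qed.

End Pictures.

Theorem lemma2 (R : realType) (n l : nat) (n_gt0 : (0 < n)%N) (l_gt0 : (0 < l)%N)
    (C : R) (C_gt0 : 0 < C)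
    (x : 'I_l -> 'rV[R]_n) (y : 'I_l -> R)
    (y_label : forall i : 'I_l, y i = -1 \/ y i = 1)
    (xnew : 'rV[R]_n)
    (has_pos : exists i : 'I_l, y i = 1)
    (has_neg : exists i : 'I_l, y i = -1) :
  support_vector C (picture (fun i => (x i, y i)) xnew 1) ord_max \/
  support_vector C (picture (fun i => (x i, y i)) xnew (-1)) ord_max.
Proof.
set z := fun i => (x i, y i).
have solvable v : v = -1 \/ v = 1 ->
    exists w b xi, is_unique_solution C (picture z xnew v) w b xi.
  move=> v_label; have [i yi] := has_pos; have [j yj] := has_neg.
  apply: exists_unique_solution => //.
  - by move=> k; case: (unliftP ord_max k) => [k'|] ->;
      rewrite ?picture_lift ?picture_max//=.
  - by exists (lift ord_max i); rewrite picture_lift.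
  - by exists (lift ord_max j); rewrite picture_lift.
have [w [b [xi u]]] : exists w b xi, is_unique_solution C (picture z xnew 1) w b xi.
  by apply: solvable; right.
have [w' [b' [xi' u']]] :
    exists w b xi, is_unique_solution C (picture z xnew (-1)) w b xi.
  by apply: solvable; left.
apply: contrapT => /not_orP[nsv nsv'].
have [xi0 m] := nonsupport_slack0 C_gt0 nsv u.
have [xi'0 m'] := nonsupport_slack0 C_gt0 nsv' u'.
have [[[f _] _] [[f' _] _]] := (u, u').
have [ww bb] : w' = w /\ b' = b.
  have [le_o|/ltW le_o] := leP (objective C w' xi') (objective C w xi).
    exact: nonsupport_solution_eq C_gt0 u xi0 m f' xi'0 le_o.
  by have [-> ->] := nonsupport_solution_eq C_gt0 u' xi'0 m' f xi0 le_o.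
by move: m m'; rewrite ww bb; lra.
Qed.
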